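(* Let $X=\alpha_1\times\dots\times\alpha_n$ be a cartesian product of $n\ge1$ infinite ordinals and let $k_1,\dots,k_m\in\mathbb{N}$. Then $$\mathbf{w}(X\times k_1\times\dots\times k_m)=\mathbf{w}(X)\otimes k_1\otimes\dots\otimes k_m.$$
   Context: Each $k_j\in\mathbb{N}$ is viewed as the finite ordinal (chain) $\{0<1<\dots<k_j-1\}$; products have the componentwise order. The width $\mathbf{w}(A)$ of a wqo $A$ is the rank of the forest of nonempty finite sequences of pairwise incomparable elements of $A$ ordered by initial segment. $\otimes$ is the natural (Hessenberg) product of ordinals. *)

(* Defs.v *)
From Stdlib Require List.
From mathcomp Require Import all_boot.

Set Implicit Arguments.
Unset Strict Implicit.
Unset Printing Implicit Defensive.

(* Ordinals.  [osup I f] denotes  sup_{i : I} ( [f i] + 1 ).           *)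
Inductive ord : Type := osup : forall I : Type, (I -> ord) -> ord.

Fixpoint ole (x y : ord) : Prop :=
  match x, y with
  | @osup X f, @osup Y g => forall i : X, exists j : Y, ole (f i) (g j)
  end.

Definition oeq (x y : ord) : Prop := ole x y /\ ole y x.

Definition ozero : ord := osup (fun e : Empty_set => match e with end).

(* Natural (Hessenberg) sum: x (+) y is the least ordinal strictly above
   all x' (+) y and x (+) y' for x' < x, y' < y. *)
Fixpoint nsum (x : ord) : ord -> ord :=
  match x with
  | @osup X f =>
    fix inner (y : ord) : ord :=
      match y with
      | @osup Y g =>
        osup (fun s : X + Y =>
                match s with
                | inl i => nsum (f i) y
                | inr j => inner (g j)
                end)
      end
  end.

Fixpoint nmul_nat (a : ord) (k : nat) : ord :=
  match k with
  | O => ozero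
  | S k' => nsum (nmul_nat a k') a
  end.

(* R c t means: node c lies strictly above t (c is a proper extension *)
(* of t).  rho is the rank function: rho t = sup_{R c t} (rho c + 1). *)
Definition rank_fun (T : Type) (R : T -> T -> Prop) (rho : T -> ord) : Prop :=
  forall t : T,
    oeq (rho t) (osup (fun c : {c : T | R c t} => rho (proj1_sig c))).

Definition forest_rank (T : Type) (R : T -> T -> Prop) (o : ord) : Prop :=
  exists rho : T -> ord, rank_fun R rho /\ oeq o (osup rho).

Definition incomp (T : Type) (le : T -> T -> Prop) (x y : T) : Prop :=
  ~ le x y /\ ~ le y x.

Fixpoint pw_incomp (T : Type) (le : T -> T -> Prop) (s : list T) : Prop :=
  match s with
  | nil => True
  | x :: s' => (forall y, List.In y s' -> incomp le x y) /\ pw_incomp le s'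
  end.

Definition inc_seq (T : Type) (le : T -> T -> Prop) : Type :=
  {s : list T | s <> nil /\ pw_incomp le s}.

Definition ext_rel (T : Type) (le : T -> T -> Prop) (c t : inc_seq le) : Prop :=
  exists u : list T, u <> nil /\ proj1_sig c = proj1_sig t ++ u.

Definition width_is (T : Type) (le : T -> T -> Prop) (o : ord) : Prop :=
  forest_rank (@ext_rel T le) o.

Record well_order (T : Type) (le : T -> T -> Prop) : Prop := {
  wo_refl : forall x, le x x;
  wo_antisym : forall x y, le x y -> le y x -> x = y;
  wo_trans : forall x y z, le x y -> le y z -> le x z;
  wo_total : forall x y, le x y \/ le y x;
  wo_wf : well_founded (fun x y => le x y /\ x <> y)
}.

Definition infinite_type (T : Type) : Prop :=
  forall s : list T, exists x : T, ~ List.In x s.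

Definition pi_le (n : nat) (A : 'I_n -> Type) (leA : forall i, A i -> A i -> Prop)
  (x y : forall i : 'I_n, A i) : Prop :=
  forall i : 'I_n, leA i (x i) (y i).

Definition box_le (m : nat) (k : 'I_m -> nat)
  (x y : forall j : 'I_m, 'I_(k j)) : Prop :=
  forall j : 'I_m, (nat_of_ord (x j) <= nat_of_ord (y j))%N.

Definition pair_le (T U : Type) (leT : T -> T -> Prop) (leU : U -> U -> Prop)
  (p q : T * U) : Prop :=
  leT p.1 q.1 /\ leU p.2 q.2.

(* Main.v *)
(* Write each factor as a decreasing sum of indecomposable blocks; a multi-index s
   selects a block B_s of X, called low when some s_i = 0.  Both widths are natural
   sums of w(B_s) over the low s, taken once for each point of K = k_1 x ... x k_m.
   Upper bound: X is the union of the diagonals {s + (d,...,d)}; distinct blocks of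
   a diagonal are entirely comparable and each embeds in the low one.
   Lower bound: w(B_s) is indecomposable.  Play the low blocks of X x K in order of
   increasing width, larger blocks first among equals; since the first block of each
   factor is a limit, finitely many moves leave a copy of every block still to be
   played incomparable to them.  This gives the ordinary sum of the w(B_s) in
   decreasing order, which is their natural sum. *)
From Stdlib Require Import Classical ClassicalEpsilon FunctionalExtensionality.
Require Import Defs.
From mathcomp Require Import all_boot.

Set Implicit Arguments.
Unset Strict Implicit.
Unset Printing Implicit Defensive.

(** The widths w(B_s) are never computed. Beyond their definition as ranks, the argument uses two
    facts: w(B_s) is additively indecomposable, and it decreases weakly as s grows. The order on K
    shapes the plays, but the resulting formula sees only the number of points of K; the theorem is
    that formula for a one-point K and for the box. No exponents of omega appear either. The blocks
    of a factor are indecomposable tails split off its order type, and the agreement of ordinary and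
    natural sums is derived from closure under addition alone. This needs closure under natural
    sums, whereas playing twice inside a block gives closure under ordinary sums only; a separate
    lemma bridges the two. *)

Lemma dep_choice (I : Type) (B : I -> Type) (R : forall i, B i -> Prop) :
  (forall i, exists b, R i b) -> exists f : forall i, B i, forall i, R i (f i).
Proof.
move=> H.
exists (fun i => proj1_sig (constructive_indefinite_description _ (H i))) => i.
exact: proj2_sig.
Qed.

(** * Ordinal arithmetic *)

Definition olt (x y : ord) : Prop :=
  match y with @osup Y g => exists j : Y, ole x (g j) end.

Lemma ole_refl x : ole x x.
Proof. by elim: x => I f IH /= i; exists i. Qed.

Lemma ole_trans y x z : ole x y -> ole y z -> ole x z.
Proof.
elim: x y z => I f IH [J g] [K h] /= fg gh i.
have [j fij] := fg i; have [k gjk] := gh j.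
by exists k; apply: IH fij gjk.
Qed.

Lemma oltW_ole x y z : olt x y -> ole y z -> olt x z.
Proof.
case: y z => J g [K h] /= [j xj] gh; have [k gk] := gh j.
by exists k; apply: ole_trans gk.
Qed.

Lemma ole_olt y x z : ole x y -> olt y z -> olt x z.
Proof. by case: z => K h /= xy [k yk]; exists k; apply: ole_trans yk. Qed.

Lemma oleP x y : ole x y <-> forall z, olt z x -> olt z y.
Proof.
split=> [xy z zx|]; first exact: oltW_ole xy.
case: x y => I f [J g] /= H i; apply: H.
by exists i; apply: ole_refl.
Qed.

Lemma oltW x y : olt x y -> ole x y.
Proof.
elim: x y => I f IH [J g] [j fgj] i; exists j; apply: IH.
by apply: oltW_ole fgj; exists i; apply: ole_refl.
Qed.

Lemma olt_trans y x z : olt x y -> olt y z -> olt x z.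
Proof. by move=> xy /oltW; apply: oltW_ole. Qed.

Lemma olt_irrefl x : ~ olt x x.
Proof.
elim: x => I f IH [i xi]; apply: (IH i).
by apply: oltW_ole (xi); exists i; apply: ole_refl.
Qed.

Lemma ole_or_olt x y : ole x y \/ olt y x.
Proof.
elim: x y => I f IH [J g] /=.
have [|/not_all_ex_not[i Hi]] := classic (forall i, exists j, ole (f i) (g j)).
  by left.
right; exists i => /=.
suff: ole (osup g) (f i) by [].
apply/oleP => z /= [j zj]; apply: ole_olt zj _.
by have [fg|//] := IH i (g j); case: Hi; exists j.
Qed.

Lemma onlt x y : ~ olt x y -> ole y x.
Proof. by have [] := ole_or_olt y x. Qed.

Lemma onle x y : ~ ole x y -> olt y x.
Proof. by have [] := ole_or_olt x y. Qed.

Lemma ole_nlt x y : ole x y -> ~ olt y x.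
Proof. by move=> xy yx; apply: (@olt_irrefl y); apply: oltW_ole xy. Qed.

Lemma olt_wf : well_founded olt.
Proof.
suff H x y : ole y x -> Acc olt y by move=> x; apply: (H x); apply: ole_refl.
elim: x y => I f IH y yx; constructor=> z zy.
by have [i zi] := oltW_ole zy yx; apply: IH zi.
Qed.

Lemma olt_ind (P : ord -> Prop) :
  (forall x, (forall y, olt y x -> P y) -> P x) -> forall x, P x.
Proof. exact: (well_founded_ind olt_wf). Qed.

Lemma least_ord (P : ord -> Prop) x :
  P x -> exists y, P y /\ forall z, P z -> ole y z.
Proof.
elim/olt_ind: x => x IH Px.
have [[y [yx Py]]|H] := classic (exists y, olt y x /\ P y); first exact: IH Py.
exists x; split=> // z Pz; apply: onlt => zx; case: H.
by exists z.
Qed.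

Lemma oeq_refl x : oeq x x.
Proof. by split; apply: ole_refl. Qed.

Lemma oeq_sym x y : oeq x y -> oeq y x.
Proof. by case. Qed.

Lemma oeq_trans y x z : oeq x y -> oeq y z -> oeq x z.
Proof. by move=> [xy yx] [yz zy]; split; apply: (@ole_trans y). Qed.

Lemma oeqP x y : (forall z, olt z x <-> olt z y) -> oeq x y.
Proof. by move=> H; split; apply/oleP => z /H. Qed.

Lemma ozero_le x : ole ozero x.
Proof. by case: x => I f []. Qed.

Lemma olt_ozero x : ~ olt x ozero.
Proof. by case; case. Qed.

Lemma osup_gt (I : Type) (f : I -> ord) i : olt (f i) (osup f).
Proof. by exists i; apply: ole_refl. Qed.

Lemma osup_le (I : Type) (f : I -> ord) z :
  (forall i, olt (f i) z) -> ole (osup f) z.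
Proof. by move=> H; apply/oleP => y [i yi]; apply: ole_olt (H i). Qed.

Fixpoint osum (x y : ord) : ord :=
  match x, y with
  | @osup X f, @osup Y g =>
    osup (fun s : X + Y => match s with inl i => f i | inr j => osum x (g j) end)
  end.

Lemma osum_le2l x y y' : ole y y' -> ole (osum x y) (osum x y').
Proof.
elim: y y' => J g IH [J' g']; case: x IH => I f IH yy' [i|j] /=.
  by exists (inl i); apply: ole_refl.
by have [j' gg'] := yy' j; exists (inr j'); apply: IH.
Qed.

Lemma osum_ltP z x y :
  olt z (osum x y) <-> olt z x \/ exists2 y', olt y' y & ole z (osum x y').
Proof.
case: x y => I f [J g]; split=> [[[i|j] zs]|[[i zi]|[y' [j y'j] zy']]].
- by left; exists i.
- by right; exists (g j) => //; exists j; apply: ole_refl.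
- by exists (inl i).
by exists (inr j); apply: ole_trans zy' _; apply: osum_le2l.
Qed.

Lemma osum_lt2l x y y' : olt y y' -> olt (osum x y) (osum x y').
Proof. by move=> yy'; apply/osum_ltP; right; exists y => //; apply: ole_refl. Qed.

Lemma osum_le2r x x' y : ole x x' -> ole (osum x y) (osum x' y).
Proof.
move=> xx'; elim/olt_ind: y => y IH; apply/oleP => z /osum_ltP[zx|[y' y'y zy']].
  by apply/osum_ltP; left; apply: oltW_ole xx'.
by apply/osum_ltP; right; exists y' => //; apply: ole_trans (IH _ y'y).
Qed.

Lemma osum_le2 x x' y y' :
  ole x x' -> ole y y' -> ole (osum x y) (osum x' y').
Proof.
by move=> xx' yy'; apply: ole_trans (osum_le2l _ yy'); apply: osum_le2r.
Qed.

Lemma osum_oeq x x' y y' :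
  oeq x x' -> oeq y y' -> oeq (osum x y) (osum x' y').
Proof. by move=> [? ?] [? ?]; split; apply: osum_le2. Qed.

Lemma osum_ge_l x y : ole x (osum x y).
Proof. by apply/oleP => z zx; apply/osum_ltP; left. Qed.

Lemma osum_ge_r x y : ole y (osum x y).
Proof.
elim/olt_ind: y => y IH; apply/oleP => z zy; apply/osum_ltP; right.
by exists z => //; apply: IH.
Qed.

Lemma osum_gt_l x y : olt ozero y -> olt x (osum x y).
Proof.
move=> y0; apply/osum_ltP; right; exists ozero => //; exact: osum_ge_l.
Qed.

Lemma osum0r x : oeq (osum x ozero) x.
Proof.
apply: oeqP => z; split=> [/osum_ltP[//|[y /olt_ozero[]]]|zx].
by apply/osum_ltP; left.
Qed.

Lemma osumA x y z : oeq (osum x (osum y z)) (osum (osum x y) z).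
Proof.
elim/olt_ind: z => z IH; apply: oeqP => w; split.
  case/osum_ltP => [wx|[v /osum_ltP[vy|[z' z'z vz']] wv]].
  - by apply/osum_ltP; left; apply/osum_ltP; left.
  - by apply/osum_ltP; left; apply/osum_ltP; right; exists v.
  apply/osum_ltP; right; exists z' => //; apply: ole_trans wv _.
  by apply: ole_trans (osum_le2l _ vz') _; case: (IH _ z'z).
case/osum_ltP => [/osum_ltP[wx|[y' y'y wy']]|[z' z'z wz']].
- by apply/osum_ltP; left.
- apply/osum_ltP; right; exists y' => //; apply: oltW_ole y'y _.
  exact: osum_ge_l.
apply/osum_ltP; right; exists (osum y z'); first exact: osum_lt2l.
by apply: ole_trans wz' _; case: (IH _ z'z).
Qed.

Lemma osum_le2lE x y y' : ole (osum x y) (osum x y') -> ole y y'.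
Proof. by move=> H; apply: onlt => /(osum_lt2l x) /ole_nlt; apply. Qed.

Lemma osum_lt2lE x y y' : olt (osum x y) (osum x y') -> olt y y'.
Proof.
by move=> H; apply: onle => /(osum_le2l x) /ole_nlt; apply.
Qed.

Lemma osum_sub x z : ole x z -> exists y, oeq (osum x y) z.
Proof.
move=> xz; have [y [zy ymin]] := least_ord (P := fun y => ole z (osum x y)) (osum_ge_r x z).
exists y; split=> //; apply/oleP => w /osum_ltP[wx|[y' y'y wy']].
  exact: oltW_ole xz.
apply: ole_olt wy' _; apply: onle => zy'.
by have /ole_nlt := ymin _ zy'; apply.
Qed.

(** * Natural sums *)

Lemma nsum_le2 x x' y y' :
  ole x x' -> ole y y' -> ole (nsum x y) (nsum x' y').
Proof.
elim: x x' y y' => I f IHx [I' f'] y.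
elim: y => J g IHy [J' g'] xx' yy' [i|j].
  have [i' ii'] := xx' i; exists (inl i').
  exact: (IHx i (f' i') (osup g) (osup g')).
have [j' jj'] := yy' j; exists (inr j').
exact: (IHy j (g' j')).
Qed.

Lemma nsum_ltP z x y : olt z (nsum x y) <->
  (exists2 x', olt x' x & ole z (nsum x' y)) \/
  (exists2 y', olt y' y & ole z (nsum x y')).
Proof.
case: x y => I f [J g]; split=> [[[i|j] zs]|].
- by left; exists (f i) => //; apply: osup_gt.
- by right; exists (g j) => //; apply: osup_gt.
case=> [[x' [i x'i] zx']|[y' [j y'j] zy']].
  exists (inl i); apply: ole_trans zx' _.
  by apply: (@nsum_le2 x' (f i)) => //; apply: ole_refl.
exists (inr j); apply: ole_trans zy' _.
by apply: (@nsum_le2 (osup f) (osup f) y' (g j)) => //; apply: ole_refl.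
Qed.

#[local] Arguments ole : simpl never.
#[local] Arguments olt : simpl never.
#[local] Arguments osum : simpl never.
#[local] Arguments nsum : simpl never.

Lemma nsum_oeq x x' y y' :
  oeq x x' -> oeq y y' -> oeq (nsum x y) (nsum x' y').
Proof. by move=> [? ?] [? ?]; split; apply: nsum_le2. Qed.

Lemma nsum_lt2l x y y' : olt y y' -> olt (nsum x y) (nsum x y').
Proof. by move=> yy'; apply/nsum_ltP; right; exists y => //; apply: ole_refl. Qed.

Lemma nsum_lt2r x x' y : olt x x' -> olt (nsum x y) (nsum x' y).
Proof. by move=> xx'; apply/nsum_ltP; left; exists x => //; apply: ole_refl. Qed.

Lemma nsum_leC x y : ole (nsum x y) (nsum y x).
Proof.
elim/olt_ind: x y => x IHx; elim/olt_ind => y IHy.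
apply/oleP => z /nsum_ltP[[x' x'x zx']|[y' y'y zy']]; apply/nsum_ltP.
  by right; exists x' => //; apply: ole_trans zx' _; apply: IHx.
by left; exists y' => //; apply: ole_trans zy' _; apply: IHy.
Qed.

Lemma nsumC x y : oeq (nsum x y) (nsum y x).
Proof. by split; apply: nsum_leC. Qed.

Lemma nsumA x y z : oeq (nsum x (nsum y z)) (nsum (nsum x y) z).
Proof.
elim/olt_ind: x y z => x IHx; elim/olt_ind => y IHy; elim/olt_ind => z IHz.
apply: oeqP => w; split.
  case/nsum_ltP => [[x' x'x wv]|[v /nsum_ltP[[y' y'y vy']|[z' z'z vz']] wv]].
  - apply: (@ole_olt (nsum (nsum x' y) z)).
      by apply: ole_trans wv _; case: (IHx _ x'x y z).
    by do 2![apply: nsum_lt2r].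
  - apply: (@ole_olt (nsum (nsum x y') z)).
      apply: ole_trans wv _; case: (IHy _ y'y z) => H _.
      by apply: ole_trans H; apply: nsum_le2 vy'; apply: ole_refl.
    by apply: nsum_lt2r; apply: nsum_lt2l.
  apply: (@ole_olt (nsum (nsum x y) z')).
    apply: ole_trans wv _; case: (IHz _ z'z) => H _.
    by apply: ole_trans H; apply: nsum_le2 vz'; apply: ole_refl.
  exact: nsum_lt2l.
case/nsum_ltP => [[v /nsum_ltP[[x' x'x vx']|[y' y'y vy']] wv]|[z' z'z wz']].
- apply: (@ole_olt (nsum x' (nsum y z))).
    apply: ole_trans wv _; case: (IHx _ x'x y z) => _.
    by apply: ole_trans; apply: nsum_le2 vx' _; apply: ole_refl.
  exact: nsum_lt2r.
- apply: (@ole_olt (nsum x (nsum y' z))).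
    apply: ole_trans wv _; case: (IHy _ y'y z) => _.
    by apply: ole_trans; apply: nsum_le2 vy' _; apply: ole_refl.
  by apply: nsum_lt2l; apply: nsum_lt2r.
apply: (@ole_olt (nsum x (nsum y z'))).
  by apply: ole_trans wz' _; case: (IHz _ z'z).
by do 2![apply: nsum_lt2l].
Qed.

Lemma nsum0r x : oeq (nsum x ozero) x.
Proof.
elim/olt_ind: x => x IH; apply: oeqP => z; split.
  case/nsum_ltP => [[x' x'x zx']|[y /olt_ozero[]]].
  by apply: ole_olt (x'x); apply: ole_trans zx' _; case: (IH _ x'x).
move=> zx; apply/nsum_ltP; left; exists z => //.
by case: (IH _ zx).
Qed.

Lemma nsum0l x : oeq (nsum ozero x) x.
Proof. exact: oeq_trans (nsumC _ _) (nsum0r x). Qed.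

Lemma nsumCA x y z : oeq (nsum x (nsum y z)) (nsum y (nsum x z)).
Proof.
apply: oeq_trans (nsumA _ _ _) _; apply: oeq_trans (oeq_sym (nsumA _ _ _)).
by apply: nsum_oeq (oeq_refl z); apply: nsumC.
Qed.

Lemma nsum_oeql x y y' : oeq y y' -> oeq (nsum x y) (nsum x y').
Proof. by apply: nsum_oeq; apply: oeq_refl. Qed.

Lemma nsum_ge_l x y : ole x (nsum x y).
Proof.
apply: (@ole_trans (nsum x ozero)); first by case: (nsum0r x).
by apply: nsum_le2; [apply: ole_refl | apply: ozero_le].
Qed.

Lemma osum_le_nsum x y : ole (osum x y) (nsum x y).
Proof.
elim/olt_ind: y => y IH; apply/oleP => z /osum_ltP[zx|[y' y'y zy']].
  exact: oltW_ole (nsum_ge_l x y).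
by apply: ole_olt (nsum_lt2l x y'y); apply: ole_trans zy' (IH _ y'y).
Qed.

Lemma nmul_nat_le a b k : ole a b -> ole (nmul_nat a k) (nmul_nat b k).
Proof. by move=> ab; elim: k => [|k IH]; [apply: ole_refl|apply: nsum_le2]. Qed.

Lemma nmul_nat_oeq a b k : oeq a b -> oeq (nmul_nat a k) (nmul_nat b k).
Proof. by case=> ab ba; split; apply: nmul_nat_le. Qed.

Lemma nmul_nat1 a : oeq (nmul_nat a 1) a.
Proof. exact: nsum0l. Qed.

Lemma nmul_natDr a k l :
  oeq (nmul_nat a (k + l)) (nsum (nmul_nat a k) (nmul_nat a l)).
Proof.
elim: l => [|l IH]; first by rewrite addn0; apply/oeq_sym/nsum0r.
rewrite addnS /=; apply: oeq_trans (nsum_oeq IH (oeq_refl a)) _.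
exact/oeq_sym/nsumA.
Qed.

Lemma nmul_natDl a b k :
  oeq (nmul_nat (nsum a b) k) (nsum (nmul_nat a k) (nmul_nat b k)).
Proof.
elim: k => [|k IH]; first exact/oeq_sym/nsum0r.
apply: oeq_trans (nsum_oeq IH (oeq_refl _)) _.
apply: oeq_trans (oeq_sym (nsumA _ _ _)) _.
apply: oeq_trans (nsumA _ _ _); apply: nsum_oeql.
exact: nsumCA.
Qed.

Lemma nmul_natM a k l : oeq (nmul_nat (nmul_nat a k) l) (nmul_nat a (k * l)).
Proof.
elim: l => [|l IH]; first by rewrite muln0; apply: oeq_refl.
rewrite mulnS addnC; apply: oeq_trans (oeq_sym (nmul_natDr _ _ _)).
exact: nsum_oeq IH (oeq_refl _).
Qed.

Lemma foldl_nmul_nat a s :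
  oeq (foldl nmul_nat a s) (nmul_nat a (foldr muln 1 s)).
Proof.
elim: s a => [|k s IH] a /=; first exact/oeq_sym/nmul_nat1.
exact: oeq_trans (IH _) (nmul_natM _ _ _).
Qed.

Section IteratedSum.
Variable I : eqType.
Implicit Types (F G : I -> ord) (l : seq I).

Definition nsumL F l : ord := foldr (fun b acc => nsum (F b) acc) ozero l.

Lemma nsumL_le F G l :
  (forall b, b \in l -> ole (F b) (G b)) -> ole (nsumL F l) (nsumL G l).
Proof.
elim: l => [|b l IH] FG /=; first exact: ole_refl.
apply: nsum_le2; first by apply: FG; rewrite mem_head.
by apply: IH => c cl; apply: FG; rewrite inE cl orbT.
Qed.

Lemma nsumL_lt F G l b :
  (forall c, c \in l -> ole (F c) (G c)) -> b \in l -> olt (F b) (G b) ->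
  olt (nsumL F l) (nsumL G l).
Proof.
elim: l => // c l IH FG; rewrite inE => /predU1P[<-|bl] Fb /=.
  apply: oltW_ole (nsum_lt2r _ Fb) _; apply: nsum_le2; first exact: ole_refl.
  by apply: nsumL_le => d dl; apply: FG; rewrite inE dl orbT.
apply: ole_olt (nsum_lt2l _ (IH _ bl Fb)).
  by apply: nsum_le2 (ole_refl _); apply: FG; rewrite mem_head.
by move=> d dl; apply: FG; rewrite inE dl orbT.
Qed.

Lemma nsumL_rem F l b :
  b \in l -> oeq (nsumL F l) (nsum (F b) (nsumL F (rem b l))).
Proof.
elim: l => // c l IH; rewrite inE /= [b == c]eq_sym.
case: eqVneq => [->|_] /= bl; first exact: oeq_refl.
by apply: oeq_trans (nsumCA _ _ _); apply/nsum_oeql/IH.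
Qed.

Lemma nsumL_cat F l l' :
  oeq (nsumL F (l ++ l')) (nsum (nsumL F l) (nsumL F l')).
Proof.
elim: l => [|b l IH] /=; first exact/oeq_sym/nsum0l.
exact: oeq_trans (nsum_oeql _ IH) (nsumA _ _ _).
Qed.

(** To get below a natural sum it suffices to lower a single term. This is the form in which
    [nsum_le_osum] looks at the ordinals below its left summand. *)
Lemma nsumL_ltP F l z : olt z (nsumL F l) ->
  exists b w, [/\ b \in l, olt w (F b) & ole z (nsum w (nsumL F (rem b l)))].
Proof.
elim: l z => [|c l IH] z /=; first by move=> /olt_ozero.
case/nsum_ltP => [[w wc zw]|[v vl zv]].
  by exists c, w; rewrite mem_head eqxx.
have [b [w [bl wb vw]]] := IH _ vl; exists b, w.
have zle : ole z (nsum w (nsum (F c) (nsumL F (rem b l)))).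
  apply: ole_trans zv _; case: (nsumCA w (F c) (nsumL F (rem b l))) => _.
  by apply: ole_trans; apply: nsum_le2 vw; apply: ole_refl.
rewrite inE bl orbT; split=> //.
case: eqVneq => [cb|_] //; rewrite -?cb.
apply: ole_trans zle _; apply: nsum_le2; first exact: ole_refl.
by rewrite cb; case: (nsumL_rem F bl).
Qed.

End IteratedSum.

Lemma nsumL_pairs (I J : eqType) (F : I -> ord) (l : seq I) (l' : seq J) :
  oeq (nsumL (fun b => F b.1) [seq (i, j) | i <- l, j <- l'])
      (nmul_nat (nsumL F l) (size l')).
Proof.
elim: l => [|i l IH] /=.
  by elim: (size l') => [|k IH] /=; [apply: oeq_refl|apply: oeq_trans IH (oeq_sym (nsum0r _))].
apply: oeq_trans (nsumL_cat _ _ _) _.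
apply: oeq_trans (oeq_sym (nmul_natDl _ _ _)); apply: nsum_oeq IH.
elim: l' => [|j l' IH] /=; first exact: oeq_refl.
exact: oeq_trans (nsum_oeql _ IH) (nsumC _ _).
Qed.

(** * Indecomposable ordinals *)

Definition indec (a : ord) : Prop :=
  forall x y, olt x a -> olt y a -> olt (osum x y) a.

Definition nindec (a : ord) : Prop :=
  forall x y, olt x a -> olt y a -> olt (nsum x y) a.

(** An exchange argument by induction on [v]. Lowering [S] to [x] lowers one term [W] to [w]. If
    [v < W], then [w] and [v] together fit inside [W], and the result is below [S]. If [W <= v],
    then [v] can take the place of [W], which restores [S] and leaves the smaller right summand [w].
    The hypothesis is abstract so as to cover both lists of terms and multiples of one term. *)
Lemma nsum_le_osum (S v0 : ord) :
  (forall x, olt x S -> exists W w S', [/\ nindec W, ole v0 W, olt w W,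
     ole x (nsum w S') & ole (nsum W S') S]) ->
  forall v, ole v v0 -> ole (nsum S v) (osum S v).
Proof.
move=> HS; elim/olt_ind => v IH vv0; apply/oleP => z.
case/nsum_ltP => [[x xS zx]|[v' v'v zv']]; last first.
  apply: ole_olt (osum_lt2l S v'v); apply: ole_trans zv' (IH _ v'v _).
  exact: ole_trans (oltW v'v) vv0.
have [W [w [S' [Wnd v0W wW xw WS]]]] := HS x xS.
have zwv : ole z (nsum (nsum w v) S').
  apply: ole_trans zx _; apply: ole_trans (nsum_le2 xw (ole_refl v)) _.
  apply: (@ole_trans (nsum w (nsum S' v))); first by case: (nsumA w S' v).
  apply: (@ole_trans (nsum w (nsum v S'))); last by case: (nsumA w v S').
  by apply: nsum_le2 (ole_refl _) _; apply: nsum_leC.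
have [Wv|vW] := ole_or_olt W v; last first.
  apply: ole_olt zwv _; apply: oltW_ole (osum_ge_l S v).
  by apply: oltW_ole WS; apply: nsum_lt2r; apply: Wnd.
(* Here [v] replaces [W], which is at least [v0] and so at least [v]; the induction hypothesis is
   applied at [w < v]. *)
have wv := oltW_ole wW Wv.
apply: ole_olt (osum_lt2l S wv).
apply: ole_trans (IH _ wv (ole_trans (oltW wv) vv0)).
apply: ole_trans zwv _; apply: (@ole_trans (nsum w (nsum v S'))).
  by case: (nsumA w v S').
apply: ole_trans (nsum_leC _ _) _; apply: nsum_le2 (ole_refl _).
apply: ole_trans WS; apply: nsum_le2 (ole_refl _).
exact: ole_trans vv0 v0W.
Qed.

Lemma nsumL_le_osum (I : eqType) (F : I -> ord) (l : seq I) v :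
  (forall b, b \in l -> nindec (F b)) -> (forall b, b \in l -> ole v (F b)) ->
  ole (nsum (nsumL F l) v) (osum (nsumL F l) v).
Proof.
move=> Fnd vF; apply: nsum_le_osum (ole_refl v) => x /nsumL_ltP[b [w [bl wb xw]]].
exists (F b), w, (nsumL F (rem b l)); split; auto.
by case: (nsumL_rem F bl).
Qed.

Fixpoint omul_nat (a : ord) (k : nat) : ord :=
  if k is k'.+1 then osum (omul_nat a k') a else ozero.

Lemma nmul_nat_ltP V k z : olt z (nmul_nat V k) ->
  exists w k', [/\ k = k'.+1, olt w V & ole z (nsum w (nmul_nat V k'))].
Proof.
elim: k z => [|k IH] z; first by move=> /olt_ozero.
case/nsum_ltP => [[v vV zv]|[w wV zw]]; last first.
  by exists w, k; split=> //; apply: ole_trans zw (nsum_leC _ _).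
have [w [k' [-> wV vw]]] := IH _ vV; exists w, k'.+1; split=> //.
apply: ole_trans zv _; apply: ole_trans (nsum_le2 vw (ole_refl V)) _.
by case: (nsumA w (nmul_nat V k') V).
Qed.

Lemma nmul_nat_le_omul V k : nindec V -> ole (nmul_nat V k) (omul_nat V k).
Proof.
move=> Vnd; elim: k => [|k IH] /=; first exact: ole_refl.
apply: ole_trans (osum_le2r _ IH); apply: nsum_le_osum (ole_refl V) => x.
case/nmul_nat_ltP => w [k' [-> wV xw]].
exists V, w, (nmul_nat V k'); split=> //; first exact: ole_refl.
exact: nsum_leC.
Qed.

Lemma indec_omul a v k : olt ozero a -> indec a -> olt v a -> olt (omul_nat v k) a.
Proof. by move=> a0 Ha va; elim: k => //= k IH; apply: Ha. Qed.

Lemma omax (P : ord -> Prop) x y : P x -> P y -> exists m, [/\ P m, ole x m & ole y m].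
Proof.
move=> Px Py; have [xy|/oltW yx] := ole_or_olt x y.
  by exists y; split=> //; apply: ole_refl.
by exists x; split=> //; apply: ole_refl.
Qed.

(* Given r < a, the least V such that r is below a finite natural multiple of V
   is closed under natural sums, and V <= r < a. *)
Lemma indec_nindec a : indec a -> nindec a.
Proof.
move=> Ha x y /(omax (P := fun z => olt z a)) H /H[r [ra xr yr]].
apply: ole_olt (nsum_le2 xr yr) _ => {x y H xr yr}.
have a0 : olt ozero a by apply: ole_olt (ozero_le r) ra.
have [r0|r_gt0] := ole_or_olt r ozero.
  apply: ole_olt (nsum_le2 r0 r0) _; apply: ole_olt a0.
  by case: (nsum0r ozero).
have Hr : exists k, olt r (nmul_nat r k).
  exists 2; apply: (@ole_olt (nsum ozero r)).
    by case: (nsum0l r).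
  by apply: nsum_lt2r; apply: oltW_ole r_gt0 _; case: (nmul_nat1 r).
have [V [[k rVk] Vmin]] := least_ord (P := fun v => exists k, olt r (nmul_nat v k)) Hr.
have Vnd : nindec V.
  move=> u v /(omax (P := fun z => olt z V)) H /H[m [mV um vm]].
  apply: onle => VS; apply: (@olt_irrefl m); apply: oltW_ole mV _.
  apply: Vmin; exists (k + k); apply: oltW_ole rVk _.
  apply: ole_trans (nmul_nat_le k VS) _.
  apply: ole_trans (nmul_nat_le k (nsum_le2 um vm)) _.
  apply: (@ole_trans (nsum (nmul_nat m k) (nmul_nat m k))).
    by case: (nmul_natDl m m k).
  by case: (nmul_natDr m k k).
have Va : olt V a by apply: ole_olt (Vmin _ Hr) ra.
(* Natural multiples of [V] are bounded by ordinary ones because [V] is closed under natural sums;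
   ordinary multiples of [V < a] stay below [a] by [indec]. *)
apply: ole_olt (indec_omul (k + k) a0 Ha Va).
apply: ole_trans (nmul_nat_le_omul _ Vnd).
apply: (@ole_trans (nsum (nmul_nat V k) (nmul_nat V k))).
  by apply: nsum_le2; apply: oltW.
by case: (nmul_natDr V k k).
Qed.
(** * Cantor normal form *)

Lemma osum0l x : oeq (osum ozero x) x.
Proof.
split; last exact: osum_ge_r.
exact: ole_trans (osum_le_nsum _ _) (proj1 (nsum0l x)).
Qed.

(** Take [w] to be the least nonzero tail of [a], and then [b] least for this [w]. Any tail of [w]
    is a tail of [a], so removing an [x < w] from the front of [w] leaves at least [w]: this gives
    indecomposability, and [w] absorbs [x] on its left. The last clause follows, since an end [w']
    of [b] smaller than [w] would be absorbed, contradicting the choice of [b]. *)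
Lemma last_term a : olt ozero a -> exists b w,
  [/\ olt b a, olt ozero w, indec w, oeq a (osum b w) &
      forall b' w', olt w' w -> ~ (olt b' b /\ oeq b (osum b' w'))].
Proof.
move=> a0.
pose P w := olt ozero w /\ exists b, oeq a (osum b w).
have Pa : P a by split=> //; exists ozero; apply/oeq_sym/osum0l.
have [w [[w0 Hw] wmin]] := least_ord Pa.
have [b0 ab0] := Hw.
have [b [ab bmin]] := least_ord (P := fun b => oeq a (osum b w)) ab0.
have rem_w x : olt x w -> exists y, [/\ ole w y & oeq (osum x y) w].
  move=> xw; have [y xyw] := osum_sub (oltW xw); exists y; split=> //.
  apply: wmin; split.
    apply: onle => y0; apply: (ole_nlt (x := w) (y := x)) xw.
    apply: ole_trans (proj2 xyw) _; apply: ole_trans (osum_le2l _ y0) _.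
    by case: (osum0r x).
  exists (osum b x); apply: oeq_trans ab _.
  apply: oeq_trans (osumA _ _ _).
  by apply: osum_oeq (oeq_refl b) (oeq_sym xyw).
exists b, w; split=> //.
- by apply: oltW_ole (osum_gt_l b w0) _; case: ab.
- move=> x y xw yw; apply: onle => wxy; have [z [wz xz]] := rem_w _ xw.
  apply: (ole_nlt (x := z) (y := y)); last exact: oltW_ole wz.
  by apply: (@osum_le2lE x); apply: ole_trans wxy; case: xz.
move=> b' w' w'w [b'b bb']; have [z [wz xz]] := rem_w _ w'w.
apply: (ole_nlt _ b'b); apply: bmin; apply: oeq_trans ab _.
apply: oeq_trans (osum_oeq bb' (oeq_refl w)) _.
apply: oeq_trans (oeq_sym (osumA _ _ _)) _.
apply: osum_oeq (oeq_refl b') _; split; last exact: osum_ge_r.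
by apply: ole_trans (proj1 xz); apply: osum_le2l.
Qed.

Fixpoint osumn (C : nat -> ord) (n : nat) : ord :=
  if n is n'.+1 then osum (osumn C n') (C n') else ozero.

Lemma eq_osumn C C' n : (forall t, t < n -> C t = C' t) -> osumn C n = osumn C' n.
Proof.
elim: n => //= n IH H; rewrite IH ?H // => t tn; apply: H; exact: ltnW.
Qed.

Lemma osumn_le C m n : m <= n -> ole (osumn C m) (osumn C n).
Proof.
move/subnKC <-; elim: (n - m) => [|k IH]; first by rewrite addn0; apply: ole_refl.
by rewrite addnS; apply: ole_trans IH (osum_ge_l _ _).
Qed.

(** Terms are repeated rather than given coefficients, and only the values of [C] below [L] matter.
    Peeling off last terms keeps the list decreasing by the last clause of [last_term]. *)
Lemma cantor_normal_form a : exists L C, [/\ oeq a (osumn C L),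
  forall t, t < L -> olt ozero (C t) /\ indec (C t) &
  forall t, t.+1 < L -> ole (C t.+1) (C t)].
Proof.
elim/olt_ind: a => a IH.
have [a0|/last_term[b [w [ba w0 wi ab bmin]]]] := ole_or_olt a ozero.
  by exists 0, (fun=> ozero); split=> //; split=> //; apply: ozero_le.
have [L [C [bC Cpos Cle]]] := IH b ba.
pose C' t := if t < L then C t else w.
have C'E : osumn C' L = osumn C L by apply: eq_osumn => t tL; rewrite /C' tL.
exists L.+1, C'; split=> /= [|t|t].
- rewrite C'E /C' ltnn; apply: oeq_trans ab _.
  exact: osum_oeq bC (oeq_refl w).
- by rewrite /C' ltnS => _; case: ifP => [/Cpos|].
rewrite ltnS /C' => tL; rewrite tL; case: ifP => [|tL']; first exact: Cle.
apply: onlt => Ctw; apply: (bmin (osumn C t) (C t) Ctw).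
have LE : L = t.+1 by apply/eqP; rewrite eqn_leq leqNgt tL' tL.
rewrite LE in bC.
split=> //; apply: oltW_ole (proj2 bC) => /=.
by apply: osum_gt_l; case: (Cpos t tL).
Qed.

Lemma osumn_split C L o : olt o (osumn C L) ->
  exists t o', [/\ t < L, olt o' (C t) & oeq o (osum (osumn C t) o')].
Proof.
elim: L => [|L IH] /= oL; first by case: (olt_ozero oL).
have [/osum_sub[o' oE]|/IH[t [o' [tL o't oE]]]] := ole_or_olt (osumn C L) o.
  exists L, o'; split=> //; last exact: oeq_sym.
  by apply: (@osum_lt2lE (osumn C L)); apply: ole_olt oL; case: oE.
by exists t, o'; split=> //; apply: ltnW.
Qed.

Lemma osumn_lt C t t' o o' : t < t' -> olt o (C t) ->
  olt (osum (osumn C t) o) (osum (osumn C t') o').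
Proof.
move=> tt' oC; apply: oltW_ole (osum_ge_l _ _).
exact: oltW_ole (osum_lt2l _ oC) (osumn_le C (m := t.+1) tt').
Qed.

Lemma osumn_leE C t t' o o' : olt o (C t) -> olt o' (C t') ->
  ole (osum (osumn C t) o) (osum (osumn C t') o') <->
  t < t' \/ t = t' /\ ole o o'.
Proof.
move=> oC o'C; split=> [H|[tt'|[<- oo']]].
- case: (ltngtP t t') => [tt'|t't|tt']; first by left.
    by case: (ole_nlt H); apply: osumn_lt.
  by right; split=> //; rewrite tt' in H; apply: osum_le2lE H.
- exact/oltW/osumn_lt.
exact: osum_le2l.
Qed.

(** * Ranks *)

Definition wrank (T : Type) (R : T -> T -> Prop) (wf : well_founded R) : T -> ord :=
  Fix wf (fun=> ord)
    (fun t rk => osup (fun c : {c : T | R c t} => rk (proj1_sig c) (proj2_sig c))).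

Lemma wrankP (T : Type) (R : T -> T -> Prop) (wf : well_founded R) :
  rank_fun R (wrank wf).
Proof.
move=> t; rewrite {1}/wrank Fix_eq; first exact: oeq_refl.
move=> x f g fg; congr osup; apply: functional_extensionality => c; exact: fg.
Qed.

Lemma rank_ltP (T : Type) (R : T -> T -> Prop) rho t z :
  rank_fun R rho -> olt z (rho t) <-> exists2 c, R c t & ole z (rho c).
Proof.
move=> /(_ t)[le1 le2]; split=> [/oltW_ole/(_ le1)[[c Rct] zc]|[c Rct zc]].
  by exists c.
by apply: oltW_ole le2; exists (exist _ c Rct).
Qed.

Lemma rank_lt (T : Type) (R : T -> T -> Prop) rho c t :
  rank_fun R rho -> R c t -> olt (rho c) (rho t).
Proof. by move=> H Rct; apply/(rank_ltP _ _ H); exists c => //; apply: ole_refl. Qed.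

(** Moves of the first tree are copied in the second, and wherever the copying stops a rank of at
    least [S] is left. [S] is the left summand because it is played last: what is played first
    stands at the right end of an ordinal sum. *)
Lemma rank_simulation (T1 T2 : Type) (R1 : T1 -> T1 -> Prop)
  (R2 : T2 -> T2 -> Prop) rho1 rho2 (Sim : T1 -> T2 -> Prop) S :
  well_founded R1 -> rank_fun R1 rho1 -> rank_fun R2 rho2 ->
  (forall u v, Sim u v -> ole S (rho2 v)) ->
  (forall u v u', Sim u v -> R1 u' u -> exists2 v', R2 v' v & Sim u' v') ->
  forall u v, Sim u v -> ole (osum S (rho1 u)) (rho2 v).
Proof.
move=> wf1 H1 H2 HS Hstep; elim/(well_founded_ind wf1) => u IH v uv.
apply/oleP => z /osum_ltP[zS|[y /(rank_ltP _ _ H1)[u' R1u yu'] zy]].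
  exact: oltW_ole (HS _ _ uv).
have [v' R2v u'v'] := Hstep _ _ _ uv R1u.
apply: ole_olt (rank_lt H2 R2v); apply: ole_trans (IH _ R1u _ u'v').
by apply: ole_trans zy _; apply: osum_le2l.
Qed.

Lemma rank_simulation0 (T1 T2 : Type) (R1 : T1 -> T1 -> Prop)
  (R2 : T2 -> T2 -> Prop) rho1 rho2 (Sim : T1 -> T2 -> Prop) :
  well_founded R1 -> rank_fun R1 rho1 -> rank_fun R2 rho2 ->
  (forall u v u', Sim u v -> R1 u' u -> exists2 v', R2 v' v & Sim u' v') ->
  forall u v, Sim u v -> ole (rho1 u) (rho2 v).
Proof.
move=> wf1 H1 H2 Hstep u v uv; apply: ole_trans (proj2 (osum0l _)) _.
by apply: (rank_simulation (Sim := Sim)) uv => // ? ? _; apply: ozero_le.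
Qed.

(** * Coordinates on a well-order *)

(* The Cantor normal form of the order type, in coordinates: block [t] has order
   type [len t], and [x] has rank [off x] inside the block [blk x]. *)
Record blocks (A : Type) (le : A -> A -> Prop) := Blocks {
  nblk : nat;
  len : nat -> ord;
  blk : A -> nat;
  off : A -> ord;
  blk_lt : forall x, blk x < nblk;
  off_lt : forall x, olt (off x) (len (blk x));
  blocks_leE : forall x y,
    le x y <-> blk x < blk y \/ blk x = blk y /\ ole (off x) (off y);
  blocks_point : forall t o, t < nblk -> olt o (len t) ->
    exists x, blk x = t /\ oeq (off x) o;
  len_le : forall t t', t <= t' -> t' < nblk -> ole (len t') (len t);
  len_gt0 : forall t, t < nblk -> olt ozero (len t);
  len_indec : forall t, t < nblk -> indec (len t);
  nblk_gt0 : 0 < nblk;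
  len0_limit : forall o, olt o (len 0) -> exists2 o', olt o o' & olt o' (len 0)
}.

Definition osucc (a : ord) : ord := osup (fun _ : unit => a).

Lemma osucc_gt a : olt a (osucc a).
Proof. exact: (osup_gt (fun _ : unit => a) tt). Qed.

Lemma osucc_le a b : olt a b -> ole (osucc a) b.
Proof. by move=> ab; apply: osup_le. Qed.

Section WellOrder.
Variables (A : Type) (le : A -> A -> Prop).
Hypothesis wo : well_order le.

Let rk : A -> ord := wrank (wo_wf wo).

Lemma wo_rank_lt x y : le x y -> x <> y -> olt (rk x) (rk y).
Proof. by move=> xy ne; apply: (rank_lt (wrankP (wo_wf wo))). Qed.

Lemma wo_rank_le x y : ole (rk x) (rk y) <-> le x y.
Proof.
split=> [H|xy].
  have [//|yx] := wo_total wo x y.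
  have [->|ne] := classic (y = x); first exact: wo_refl.
  by case: (ole_nlt H); apply: wo_rank_lt.
have [->|ne] := classic (x = y); first exact: ole_refl.
exact/oltW/wo_rank_lt.
Qed.

(** Descend from a point of rank at least [o]: as long as its rank exceeds [o], some smaller point
    still has rank at least [o]. *)
Lemma wo_rank_onto o : olt o (osup rk) -> exists x, oeq (rk x) o.
Proof.
case=> x0; elim/(well_founded_ind (wo_wf wo)): x0 => x IH ox.
have [xo|/(rank_ltP _ _ (wrankP (wo_wf wo)))[y yx oy]] := ole_or_olt (rk x) o.
  by exists x.
exact: IH oy.
Qed.

Lemma blocks_exist : infinite_type A -> inhabited (blocks le).
Proof.
move=> Ainf.
have [L [C [aE Cpos Cle]]] := cantor_normal_form (osup rk).
have /dep_choice[q qP] x : exists q : nat * ord, [/\ q.1 < L, olt q.2 (C q.1) &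
    oeq (rk x) (osum (osumn C q.1) q.2)].
  have [|t [o []]] := @osumn_split C L (rk x); last by exists (t, o).
  exact: oltW_ole (osup_gt rk x) (proj1 aE).
have qleE x y : le x y <->
    (q x).1 < (q y).1 \/ (q x).1 = (q y).1 /\ ole (q x).2 (q y).2.
  have [_ qx qxE] := qP x; have [_ qy qyE] := qP y.
  rewrite -(osumn_leE qx qy) -wo_rank_le; split=> H.
    exact: ole_trans (proj2 qxE) (ole_trans H (proj1 qyE)).
  exact: ole_trans (proj1 qxE) (ole_trans H (proj2 qyE)).
have qpoint t o : t < L -> olt o (C t) -> exists x, (q x).1 = t /\ oeq (q x).2 o.
  move=> tL oC; have [|x xE] := @wo_rank_onto (osum (osumn C t) o).
    apply: oltW_ole (proj2 aE); apply: oltW_ole (osumn_le C tL).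
    exact: osum_lt2l.
  exists x; have [_ qx qxE] := qP x.
  have E := oeq_trans (oeq_sym qxE) xE.
  have /(osumn_leE qx oC) := proj1 E; have /(osumn_leE oC qx) := proj2 E.
  case=> [t1|[tE o1]] [t2|[tE2 o2]]; try by move: (ltn_trans t1 t2); rewrite ltnn.
  - by rewrite tE2 ltnn in t1.
  - by rewrite tE ltnn in t2.
  by [].
have Clen t t' : t <= t' -> t' < L -> ole (C t') (C t).
  move/subnKC <-; elim: (t' - t) => [|k IH]; first by rewrite addn0 => _; apply: ole_refl.
  rewrite addnS => kL; apply: ole_trans (Cle _ kL) (IH _).
  exact: ltnW.
have L0 : 0 < L.
  have [x _] := Ainf nil; have [+ _ _] := qP x.
  exact: leq_trans.
(* If the longest block had at most one point, every block would, and [A] would have at most [L]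
   elements. The function [p] lists them. *)
have C1 : olt (osucc ozero) (C 0).
  apply: onle => C0.
  have /dep_choice[p pP] (t : nat) : exists x, t < L -> (q x).1 = t.
    have [x0 _] := Ainf nil.
    have [tL|] := boolP (t < L); last by exists x0.
    have [x [xt _]] := qpoint t ozero tL (proj1 (Cpos t tL)).
    by exists x.
  have [x []] := Ainf (map p (iota 0 L)).
  have [xL xC xE] := qP x.
  have -> : x = p (q x).1.
    have zero_off y : ole (q y).2 ozero.
      have [yL yC _] := qP y.
      have /(oltW_ole yC) : ole (C (q y).1) (osucc ozero).
        exact: ole_trans (Clen _ _ (leq0n _) yL) C0.
      by case.
    apply: (wo_antisym wo); apply/qleE; right; rewrite pP //; split=> //;
      exact: ole_trans (zero_off _) (ozero_le _).
  have: (q x).1 \in iota 0 L by rewrite mem_iota.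
  elim: (iota 0 L) => //= t l IH; rewrite inE => /predU1P[->|/IH]; by [left|right].
constructor; apply: (@Blocks A le L C (fun x => (q x).1) (fun x => (q x).2)) => //.
- by move=> x; case: (qP x).
- by move=> x; case: (qP x).
- by move=> t /Cpos[].
- by move=> t /Cpos[].
(* An indecomposable ordinal above 1 is closed under adding 1, hence a limit. *)
move=> o oC; exists (osucc o); first exact: osucc_gt.
have [C0 /(_ o (osucc ozero) oC C1) H] := Cpos 0 L0.
apply: ole_olt H; apply: osucc_le; apply: osum_gt_l; exact: osucc_gt.
Qed.
End WellOrder.

(** * Trees of antichains *)

(* Antichains grow at the head of the list: they are the reversals of the
   sequences in [inc_seq]. *)
Definition step (T : Type) (le : T -> T -> Prop) (P : T -> Prop)
  (u' u : seq T) : Prop :=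
  exists y, [/\ u' = y :: u, P y & forall z, List.In z u -> incomp le y z].

Definition bad_seq_free (T : Type) (le : T -> T -> Prop) : Prop :=
  forall f : nat -> T, exists i j, i < j /\ le (f i) (f j).

Lemma incomp_sym (T : Type) (le : T -> T -> Prop) x y :
  incomp le x y -> incomp le y x.
Proof. by case. Qed.

Lemma In_cat (T : Type) (x : T) s1 s2 :
  List.In x (s1 ++ s2) <-> List.In x s1 \/ List.In x s2.
Proof. exact: List.in_app_iff. Qed.

Lemma In_map (T1 T2 : Type) (e : T1 -> T2) y s :
  List.In y (map e s) -> exists2 x, y = e x & List.In x s.
Proof.
by elim: s => //= x s IH [<-|/IH[z -> zs]]; [exists x => //; left|exists z => //; right].
Qed.

Lemma In_filter (T : Type) (a : pred T) x s :
  List.In x (filter a s) -> a x /\ List.In x s.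
Proof.
elim: s => //= y s IH; case: ifP => ay /=; last by case/IH; split=> //; right.
by case=> [<-|/IH[]]; split=> //; [left|right].
Qed.

Lemma In_rev (T : Type) (x : T) s : List.In x (rev s) -> List.In x s.
Proof.
elim: s => //= y s IH; rewrite rev_cons -cats1 => /In_cat[/IH|[->|[]]]; by [right|left].
Qed.

Lemma not_wf_seq (T : Type) (R : T -> T -> Prop) :
  ~ well_founded R -> exists g : nat -> T, forall i, R (g i.+1) (g i).
Proof.
move=> nwf; have [x0 x0P] := not_all_ex_not _ _ nwf.
have /dep_choice[h hP] (x : {x | ~ Acc R x}) :
    exists y : {x | ~ Acc R x}, R (proj1_sig y) (proj1_sig x).
  apply: NNPP => H; case: x H => x xP /= H; apply: xP; constructor=> y yx.
  by apply: NNPP => yP; apply: H; exists (exist _ y yP).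
by exists (fun i => proj1_sig (iter i h (exist _ x0 x0P))) => i; apply: hP.
Qed.

(** The points added along an infinite branch would form a sequence without any increasing pair. *)
Lemma step_wf (T : Type) (le : T -> T -> Prop) P :
  bad_seq_free le -> well_founded (step le P).
Proof.
move=> Hle; apply: NNPP => /not_wf_seq[g /dep_choice[y yP]].
have yg i j : i < j -> List.In (y i) (g j).
  elim: j => // j IH; have [-> _ _] := yP j; rewrite ltnS leq_eqVlt.
  by case/predU1P => [->|/IH]; [left|right].
have [i [j [ij le_ij]]] := Hle y.
by have [_ _ /(_ _ (yg _ _ ij))[_]] := yP j.
Qed.

(** The single move of most copying strategies below: [e] reflects the order, so images of
    incomparable points are incomparable, and [v] holds earlier moves that every image avoids. *)
Lemma step_map (T1 T2 : Type) le1 (P1 : T1 -> Prop) le2 (P2 : T2 -> Prop)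
  (e : T1 -> T2) u' u v :
  (forall z, List.In z u -> P1 z) -> (forall y, P1 y -> P2 (e y)) ->
  (forall x y, P1 x -> P1 y -> le2 (e x) (e y) -> le1 x y) ->
  (forall y z, P1 y -> List.In z v -> incomp le2 (e y) z) ->
  step le1 P1 u' u -> step le2 P2 (map e u' ++ v) (map e u ++ v).
Proof.
move=> uP P12 le12 ev [y [-> Py yu]]; exists (e y); split=> //; first exact: P12.
move=> z zuv; have [zu|zv] := proj1 (In_cat _ _ _) zuv; last exact: ev.
have [x -> xu] := In_map zu.
by have [nyx nxy] := yu _ xu; split=> /le12 H; [apply: nyx|apply: nxy]; apply: H; auto.
Qed.

Section Width.
Variables (T : Type) (le : T -> T -> Prop).

Lemma pw_incomp_cat s1 s2 : pw_incomp le (s1 ++ s2) <->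
  [/\ pw_incomp le s1, pw_incomp le s2 &
      forall x y, List.In x s1 -> List.In y s2 -> incomp le x y].
Proof.
elim: s1 => [|x s1 IH] /=.
  by split=> [s2P|[_ s2P _] //]; split=> // ? ? [].
split=> [[xs /IH[s1P s2P s12]]|[[xs1 s1P] s2P s12]].
  split=> //; first by split=> // y ys1; apply: xs; apply/In_cat; left.
  by move=> y z [<-|ys1] zs2; [apply: xs; apply/In_cat; right|apply: s12].
split; last by apply/IH; split=> // y z ys1; apply: s12; right.
by move=> y /In_cat[/xs1 //|]; apply: s12; left.
Qed.

Lemma pw_incomp_rev s : pw_incomp le s -> pw_incomp le (rev s).
Proof.
elim: s => //= x s IH [xs sP]; rewrite rev_cons -cats1; apply/pw_incomp_cat.
split; [exact: IH | by [] |].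
by move=> y z yrev [<-|[]]; apply: incomp_sym; apply: xs; apply: In_rev.
Qed.

Lemma rank_cat rho v w : rank_fun (step le (fun=> True)) rho ->
  pw_incomp le (v ++ w) -> v <> [::] -> olt (rho (v ++ w)) (rho w).
Proof.
move=> Hrho; elim: v => // x v IH /= [xvw vwP] _.
have lt_x : olt (rho (x :: v ++ w)) (rho (v ++ w)).
  by apply: (rank_lt Hrho); exists x.
case: v IH xvw vwP lt_x => // y v IH _ vwP lt_x.
by apply: olt_trans lt_x (IH _ _).
Qed.

(** The empty antichain is not a node of the forest but serves as its root, so its rank is the rank
    of the forest. Passing from one-point extensions to arbitrary proper ones does not change ranks,
    since [rho] already drops strictly along longer extensions. *)
Lemma width_of_rank rho o : rank_fun (step le (fun=> True)) rho ->
  oeq o (rho [::]) -> width_is le o.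
Proof.
move=> Hrho oE; exists (fun t : inc_seq le => rho (rev (proj1_sig t))).
have extend (s : seq T) z : pw_incomp le s -> olt z (rho (rev s)) ->
    exists2 c : inc_seq le, exists2 y, proj1_sig c = s ++ [:: y] & True &
      ole z (rho (rev (proj1_sig c))).
  move=> sP /(rank_ltP _ _ Hrho)[_ [y [-> _ yP]] zy].
  have cP : s ++ [:: y] <> [::] /\ pw_incomp le (s ++ [:: y]).
    split; first by case: (s).
    apply/pw_incomp_cat; split=> // a b asP [<-|[]]; apply: incomp_sym; apply: yP.
    by apply: In_rev; rewrite revK.
  exists (exist _ (s ++ [:: y]) cP) => /=; first by exists y.
  by rewrite cats1 rev_rcons.
split=> [[t [t0 tP]]|]; [split|apply: oeq_trans oE _; split].
- apply/oleP => z /(extend _ _ tP)[c [y cE _] zc].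
  have ext : ext_rel c (exist _ t (conj t0 tP)) by exists [:: y].
  by exists (exist _ c ext).
- apply: osup_le => -[[c [c0 cP]] /= [u [u0 /= cE]]].
  rewrite cE rev_cat; apply: (rank_cat Hrho).
    by rewrite -rev_cat -cE; apply: pw_incomp_rev.
  by move=> /(congr1 rev); rewrite revK.
- by apply/oleP => z /(extend [::] z I)[c _ zc]; exists c.
apply: osup_le => -[c [c0 cP]] /=; rewrite -[rev c]cats0; apply: (rank_cat Hrho).
  by rewrite cats0; apply: pw_incomp_rev.
by move=> /(congr1 rev); rewrite revK.
Qed.

End Width.

Lemma wo_monotone_subseq (A : Type) (le : A -> A -> Prop) (f : nat -> A) :
  well_order le -> exists phi : nat -> nat,
    {homo phi : i j / i < j} /\ forall i j, i <= j -> le (f (phi i)) (f (phi j)).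
Proof.
move=> wo.
(* [h k] is an index at or beyond [k] where [f] attains its minimum over all indices from [k] on;
   iterating it yields the increasing subsequence. *)
have /dep_choice[h hP] k :
    exists m, k <= m /\ forall l, k <= l -> le (f m) (f l).
  suff H x : forall m, k <= m -> f m = x ->
      exists m, k <= m /\ forall l, k <= l -> le (f m) (f l).
    exact: (H (f k) k).
  elim/(well_founded_ind (wo_wf wo)): x => x IH m km fm.
  have [mmin|] := classic (forall l, k <= l -> le (f m) (f l)); first by exists m.
  move=> nmin; have [l nl] := not_all_ex_not _ _ nmin.
  have [kl nml] := imply_to_and _ _ nl.
  have lm : le (f l) (f m) by case: (wo_total wo (f l) (f m)).
  apply: (IH (f l) _ l kl (erefl _)); rewrite -fm; split=> // lmE.
  by apply: nml; rewrite lmE; apply: wo_refl.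
pose phi := fix phi i := if i is i'.+1 then h (phi i').+1 else h 0.
have phi_min i l : phi i <= l -> le (f (phi i)) (f l).
  case: i => [|i] /= il; first by apply: (proj2 (hP 0)).
  by apply: (proj2 (hP _)); apply: leq_trans il; case: (hP (phi i).+1).
have phi_lt : {homo phi : i j / i < j}.
  by apply: (homo_ltn ltn_trans) => i /=; case: (hP (phi i).+1).
exists phi; split=> // i j ij; apply: phi_min.
by move: ij; rewrite leq_eqVlt => /predU1P[->//|/phi_lt/ltnW].
Qed.

Lemma pi_monotone_subseq (n : nat) (A : 'I_n -> Type)
  (leA : forall i, A i -> A i -> Prop) (f : nat -> forall i, A i) :
  (forall i, well_order (leA i)) -> exists phi : nat -> nat,
    {homo phi : i j / i < j} /\
    forall i j, i <= j -> pi_le leA (f (phi i)) (f (phi j)).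
Proof.
move=> wo.
(* Coordinates are made monotone one at a time; [k] counts those already treated. *)
suff H k : exists phi : nat -> nat, {homo phi : i j / i < j} /\
    forall i j, i <= j -> forall l : 'I_n, l < k -> leA l (f (phi i) l) (f (phi j) l).
  by have [phi [philt phiP]] := H n; exists phi; split=> // i j ij l; apply: (phiP _ _ ij).
elim: k => [|k [phi [philt phiP]]]; first by exists id; split=> // i j _ l; rewrite ltn0.
have [kn|nk] := ltnP k n; last first.
  exists phi; split=> // i j ij l lk; apply: phiP => //.
  exact: leq_trans (ltn_ord l) nk.
have [psi [psilt psiP]] := wo_monotone_subseq (fun i => f (phi i) (Ordinal kn)) (wo _).
exists (phi \o psi); split=> [i j ij|i j ij l]; first by apply: philt; apply: psilt.
rewrite ltnS leq_eqVlt => /predU1P[lk|lk].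
  have -> : l = Ordinal kn by apply: val_inj.
  exact: psiP.
apply: phiP => //; move: ij; rewrite leq_eqVlt => /predU1P[->//|].
by move/psilt/ltnW.
Qed.

(** On a subsequence monotone in the infinite factors, the pigeonhole principle on its first
    [#|K|.+1] terms gives two with the same finite coordinate. *)
Lemma pi_fin_bad_seq_free (n : nat) (A : 'I_n -> Type)
  (leA : forall i, A i -> A i -> Prop) (K : finType) (leK : K -> K -> Prop)
  (T : Type) (le : T -> T -> Prop) (p : T -> forall i, A i) (q : T -> K) :
  (forall i, well_order (leA i)) -> (forall k, leK k k) ->
  (forall x y, le x y <-> pi_le leA (p x) (p y) /\ leK (q x) (q y)) ->
  bad_seq_free le.
Proof.
move=> wo leKxx leE f.
have [phi [philt phiP]] := pi_monotone_subseq (p \o f) wo.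
have [|/injectivePn[a [b ab qab]]] :=
    boolP (injectiveb (fun i : 'I_#|K|.+1 => q (f (phi i)))).
  by move=> /injectiveP/leq_card; rewrite card_ord ltnn.
have ltab : forall a b : 'I_#|K|.+1, a < b -> q (f (phi a)) = q (f (phi b)) ->
    exists i j, i < j /\ le (f i) (f j).
  move=> {a b ab qab} a b ab qab; exists (phi a), (phi b); split; first exact: philt.
  by apply/leE; rewrite qab; split=> //; apply: phiP; apply: ltnW.
case: (ltngtP a b) => [ab'|ba'|/val_inj E]; [exact: ltab qab | exact: ltab (esym qab) |].
by rewrite E eqxx in ab.
Qed.

Lemma list_bound (T : Type) (f : T -> ord) (P : T -> Prop) a u :
  olt ozero a -> (forall z, List.In z u -> P z -> olt (f z) a) ->
  exists2 c, olt c a & forall z, List.In z u -> P z -> ole (f z) c.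
Proof.
move=> a0; elim: u => [|x u IH] H; first by exists ozero.
have [|c ca cP] := IH; first by move=> z zu; apply: H; right.
have [Px|nPx] := classic (P x); last first.
  by exists c => // z [<-//|]; apply: cP.
have xa : olt (f x) a by apply: H Px; left.
have [d [da cd xd]] := omax (P := fun v => olt v a) ca xa.
by exists d => // z [<- //|zu Pz]; apply: ole_trans cd; apply: cP.
Qed.

(** * Products of well-orders *)

Lemma minimal_member (I : eqType) (prec : I -> I -> Prop) (s : seq I) :
  (forall a, ~ prec a a) -> (forall a b c, prec a b -> prec b c -> prec a c) ->
  s <> [::] -> exists2 b, b \in s & forall c, c \in s -> ~ prec c b.
Proof.
move=> irr trans; elim: s => // a [|a' s] IH _.
  by exists a => [|c]; rewrite inE // => /eqP->.
have [//|b bs bmin] := IH; have [ab|nab] := classic (prec a b).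
  exists a; first exact: mem_head.
  by move=> c; rewrite inE => /predU1P[->//|cs] ca; apply: (bmin c cs); apply: trans ab.
exists b; first by rewrite inE bs orbT.
by move=> c; rewrite inE => /predU1P[->//|]; apply: bmin.
Qed.

Section Product.
Variables (n : nat) (A : 'I_n -> Type) (leA : forall i, A i -> A i -> Prop).
Arguments leA _ _ _ : clear implicits.
Hypothesis wo : forall i, well_order (leA i).
Variable D : forall i, blocks (leA i).

Notation X := (forall i, A i).
Notation leX := (pi_le leA).

Definition bk (x : X) (i : 'I_n) : nat := blk (D i) (x i).
Definition pos (x : X) (i : 'I_n) : ord := off (D i) (x i).
Definition inblk (s : 'I_n -> nat) (x : X) : Prop := forall i, bk x i = s i.
Definition valid (s : 'I_n -> nat) : Prop := forall i, s i < nblk (D i).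

Lemma leXE x y : leX x y <->
  forall i, bk x i < bk y i \/ bk x i = bk y i /\ ole (pos x i) (pos y i).
Proof.
by split=> H i; have := H i; [move/(blocks_leE (D i))|move=> {}H; apply/(blocks_leE (D i))].
Qed.

Lemma bk_valid x : valid (bk x).
Proof. by move=> i; apply: blk_lt. Qed.

Lemma leX_bk x y : leX x y -> forall i, bk x i <= bk y i.
Proof. by move=> /leXE H i; case: (H i) => [/ltnW//|[->]]. Qed.

Lemma leX_pos x y i : leX x y -> bk x i = bk y i -> ole (pos x i) (pos y i).
Proof. by move=> /leXE/(_ i)[xy|[]//] E; rewrite E ltnn in xy. Qed.

Lemma pos_leX x y : (forall i, bk x i = bk y i) ->
  (forall i, ole (pos x i) (pos y i)) -> leX x y.
Proof. by move=> bE H; apply/leXE => i; right. Qed.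

Lemma pos_lt s x i : inblk s x -> olt (pos x i) (len (D i) (s i)).
Proof. by move=> <-; apply: off_lt. Qed.

Lemma point s (o : 'I_n -> ord) : valid s ->
  (forall i, olt (o i) (len (D i) (s i))) ->
  exists x, inblk s x /\ forall i, oeq (pos x i) (o i).
Proof.
move=> sv os; have /dep_choice[x xP] i :=
  blocks_point (b := D i) (sv i) (os i).
by exists x; split=> i; case: (xP i).
Qed.

Lemma leX_bad_seq_free : bad_seq_free leX.
Proof.
apply: (pi_fin_bad_seq_free (K := unit) (leK := fun _ _ => True) (p := id)
          (q := fun=> tt) wo) => // x y.
by split=> [|[]].
Qed.

Definition rkb (s : 'I_n -> nat) : seq X -> ord :=
  wrank (step_wf (inblk s) leX_bad_seq_free).

Definition wblk (s : 'I_n -> nat) : ord := rkb s [::].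

Lemma rkbP s : rank_fun (step leX (inblk s)) (rkb s).
Proof. exact: wrankP. Qed.

(** Later blocks of a factor are no longer than earlier ones, so keeping the offsets embeds B_s'
    into B_s. *)
Lemma wblk_le s s' : valid s' -> (forall i, s i <= s' i) ->
  ole (wblk s') (wblk s).
Proof.
move=> s'v ss'.
have sv : valid s by move=> i; apply: leq_ltn_trans (s'v i).
have /dep_choice[e eP] x : exists y, inblk s' x ->
    inblk s y /\ forall i, oeq (pos y i) (pos x i).
  have [xs'|] := classic (inblk s' x); last by exists x.
  have [|y yP] := @point s (pos x) sv; last by exists y.
  by move=> i; apply: oltW_ole (pos_lt i xs') _; apply: len_le.
apply: (rank_simulation0 (Sim := fun u v => v = map e u ++ [::] /\
  forall z, List.In z u -> inblk s' z) (step_wf _ leX_bad_seq_free)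
  (rkbP s') (rkbP s)); last by split.
move=> u v u' [-> us'] u'u; exists (map e u' ++ [::]); last first.
  by case: u'u => y [-> ys' _]; split=> // z [<-|/us'].
apply: step_map u'u => // [y /eP[]//|x y xs' ys' exy].
have [xs xE] := eP x xs'; have [ys yE] := eP y ys'.
apply: pos_leX => i; first by rewrite xs' ys'.
apply: ole_trans (proj2 (xE i)) _; apply: ole_trans (proj1 (yE i)).
by apply: leX_pos exy _; rewrite xs ys.
Qed.

(* The residual of the block above [x] survives any finite number of moves
   dominating [x]: keep the coordinates below those of [x] and push the others
   beyond the moves already played. *)
Lemma rkb_survive s x Z : valid s -> inblk s x ->
  (forall z, List.In z Z -> inblk s z /\ forall i, ole (pos x i) (pos z i)) ->
  ole (rkb s [:: x]) (rkb s Z).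
Proof.
move=> sv xs ZP.
have /dep_choice[g gP] i : exists c, olt c (len (D i) (s i)) /\
    forall z, List.In z Z -> ole (pos z i) c.
  have [|c cl cZ] := @list_bound _ (fun z => pos z i) (fun=> True)
    (len (D i) (s i)) Z (len_gt0 (sv i)).
    by move=> z zZ _; apply: pos_lt; case: (ZP z zZ).
  by exists c; split=> // z zZ; apply: cZ.
pose shift (i : 'I_n) (o o' : ord) : Prop :=
  (olt o (pos x i) -> oeq o' o) /\ (ole (pos x i) o -> oeq o' (osum (g i) o)).
have /dep_choice[e eP] y : exists y', inblk s y ->
    inblk s y' /\ forall i, shift i (pos y i) (pos y' i).
  have [ys|] := classic (inblk s y); last by exists y.
  have /dep_choice[o oP] i : exists o, olt o (len (D i) (s i)) /\
      (olt (pos y i) (pos x i) /\ o = pos y i \/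
       ole (pos x i) (pos y i) /\ o = osum (g i) (pos y i)).
    have yl := pos_lt i ys.
    have [xy|yx] := ole_or_olt (pos x i) (pos y i).
      exists (osum (g i) (pos y i)); split; last by right.
      by apply: (len_indec (b := D i)) => //; case: (gP i).
    by exists (pos y i); split=> //; left.
  have [|y' [y's y'o]] := @point s o sv; first by move=> i; case: (oP i).
  exists y' => _; split=> // i.
  have [_ [[yx oE]|[xy oE]]] := oP i; have E := y'o i; rewrite oE in E.
    by split=> // /ole_nlt/(_ yx).
  by split=> // /(ole_nlt xy).
have eref a b : inblk s a -> inblk s b -> leX (e a) (e b) -> leX a b.
  move=> as_ bs eab; have [eas aP] := eP a as_; have [ebs bP] := eP b bs.
  apply: pos_leX => i; first by rewrite as_ bs.
  have {}eab : ole (pos (e a) i) (pos (e b) i).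
    by apply: leX_pos eab _; rewrite eas ebs.
  have [al ag] := aP i; have [bl bg] := bP i.
  apply: onlt => ba; have [xa|ax] := ole_or_olt (pos x i) (pos a i).
    have {}eab := ole_trans (proj2 (ag xa)) eab.
    have [xb|bx] := ole_or_olt (pos x i) (pos b i).
      apply: (ole_nlt _ ba); apply: (@osum_le2lE (g i)).
      exact: ole_trans eab (proj1 (bg xb)).
    apply: (ole_nlt _ ba); apply: ole_trans (osum_ge_r (g i) _) _.
    exact: ole_trans eab (proj1 (bl bx)).
  have bx := olt_trans ba ax.
  apply: (ole_nlt _ ba); apply: ole_trans (proj2 (al ax)) _.
  exact: ole_trans eab (proj1 (bl bx)).
(* The residual at [x] is played on the points incomparable to [x]. Antichains grow at the head, so
   [x] stays at the tail of [u]. *)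
pose P y := inblk s y /\ incomp leX y x.
apply: (rank_simulation0 (Sim := fun u v => exists2 w, u = w ++ [:: x] &
  v = map e w ++ Z /\ forall z, List.In z w -> P z)
  (step_wf _ leX_bad_seq_free) (rkbP s) (rkbP s)); last by exists [::].
move=> u v u' [w uE [vE wP]] [y [u'E ys yw]]; subst u v u'.
have yP : P y by split=> //; apply: yw; apply/In_cat; right; left.
exists (map e (y :: w) ++ Z); last first.
  by exists (y :: w) => //; split=> // z [<-|/wP].
apply: (step_map (le1 := leX) (P1 := P)) => //.
- by move=> a [as_ _]; case: (eP a as_).
- by move=> a b [as_ _] [bs _]; apply: eref.
(* Being incomparable to [x], the point [a] exceeds [x] in one coordinate, where its image passes
   [g] and so every [z], and lies below [x] in another, where it is unmoved and so stays below every
   [z]. *)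
- move=> a z [as_ [nax nxa]] zZ; have [zs zx] := ZP z zZ.
  have [eas aP] := eP a as_; split=> H.
    apply: nax; apply: pos_leX => i; first by rewrite xs as_.
    have eaz : ole (pos (e a) i) (pos z i) by apply: leX_pos H _; rewrite eas zs.
    apply: onlt => xa; have [_ ag] := aP i; have [_ /(_ z zZ) zg] := gP i.
    apply: (ole_nlt (ole_trans eaz zg)); apply: oltW_ole (proj2 (ag (oltW xa))).
    by apply: osum_gt_l; apply: ole_olt xa; apply: ozero_le.
  apply: nxa; apply: pos_leX => i; first by rewrite xs as_.
  have zea : ole (pos z i) (pos (e a) i) by apply: leX_pos H _; rewrite eas zs.
  apply: onlt => ax; have [al _] := aP i.
  apply: (ole_nlt (ole_trans (zx i) zea)); exact: ole_olt (proj1 (al ax)) ax.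
exists y; split=> // z zw; apply: yw; apply/In_cat; by left.
Qed.

(* Any residual rank r < w(B) can be doubled: play the residual of [x]
   translated by [x], then the residual of [x] itself. *)
Lemma wblk_indec s : valid s -> indec (wblk s).
Proof.
move=> sv a b /(omax (P := fun c => olt c (wblk s))) H /H[c [cW ac bc]].
have [_ [x [-> xs _]] cx] := proj1 (rank_ltP _ _ (rkbP s)) cW.
have /dep_choice[e eP] y : exists y', inblk s y ->
    inblk s y' /\ forall i, oeq (pos y' i) (osum (pos x i) (pos y i)).
  have [ys|] := classic (inblk s y); last by exists y.
  have [|y' y'P] := @point s (fun i => osum (pos x i) (pos y i)) sv; last by exists y'.
  by move=> i; apply: (len_indec (b := D i)) => //; apply: pos_lt.
apply: (@ole_olt (osum (rkb s [:: x]) (rkb s [:: x]))).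
  by apply: osum_le2; [apply: ole_trans ac cx | apply: ole_trans bc cx].
(* The opening move is the translate of [x], so every move of the first phase dominates [x], as
   [rkb_survive] requires for the second phase. *)
apply: (@ole_olt (rkb s (map e [:: x] ++ [::]))); last first.
  apply: (rank_lt (rkbP s)); exists (e x); split=> //.
  by case: (eP x xs).
apply: (rank_simulation (Sim := fun u v => v = map e u ++ [::] /\
  forall z, List.In z u -> inblk s z) (step_wf _ leX_bad_seq_free)
  (rkbP s) (rkbP s)); last by split=> // z [<-|[]].
- move=> u v [-> us]; apply: rkb_survive => // z; rewrite cats0.
  move=> zu; have [y -> yu] := In_map zu.
  have [eys yE] := eP y (us y yu); split=> // i.
  exact: ole_trans (osum_ge_l _ _) (proj2 (yE i)).
move=> u v u' [-> us] u'u; exists (map e u' ++ [::]); last first.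
  by case: u'u => y [-> ys _]; split=> // z [<-|/us].
apply: step_map u'u => // [y /eP[]//|y z ys zs yz].
have [eys yE] := eP y ys; have [ezs zE] := eP z zs.
apply: pos_leX => i; first by rewrite ys zs.
apply: (@osum_le2lE (pos x i)); apply: ole_trans (proj2 (yE i)) _.
apply: ole_trans (proj1 (zE i)); apply: leX_pos yz _.
by rewrite eys ezs.
Qed.

Hypothesis n_gt0 : 0 < n.

(** Subtract the least block index from all of them. The offsets still fit, because blocks of
    smaller index are at least as long. *)
Lemma diagonal x : exists y d, [/\ exists i, bk y i = 0,
  forall i, bk x i = bk y i + d & forall i, oeq (pos y i) (pos x i)].
Proof.
case: (@arg_minnP _ (Ordinal n_gt0) xpredT (bk x) isT) => i0 _ dmin.
pose s i := bk x i - bk x i0.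
have sv : valid s.
  by move=> i; apply: leq_ltn_trans (bk_valid x i); apply: leq_subr.
have [|y [ys yE]] := @point s (pos x) sv.
  move=> i; apply: oltW_ole (off_lt (D i) (x i)) _; apply: len_le.
    exact: leq_subr.
  exact: bk_valid.
exists y, (bk x i0); split=> // [|i].
  by exists i0; rewrite ys /s subnn.
by rewrite ys subnK // dmin.
Qed.

Let M := \max_i nblk (D i).

(** Multi-indices are encoded in a finite type so that the low ones can be enumerated; [inord] loses
    nothing on valid ones, whose entries are below [M]. *)
Definition sidx (s : 'I_n -> nat) : {ffun 'I_n -> 'I_M.+1} := [ffun i => inord (s i)].

Lemma sidxE s i : valid s -> sidx s i = s i :> nat.
Proof.
move=> sv; rewrite ffunE inordK // ltnS; apply: leq_trans (ltnW (sv i)) _.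
exact: (leq_bigmax (F := fun i => nblk (D i))).
Qed.

Definition low (s : {ffun 'I_n -> 'I_M.+1}) : bool :=
  [exists i, s i == 0 :> nat] && [forall i, s i < nblk (D i)].

Lemma lowP (s : {ffun 'I_n -> 'I_M.+1}) :
  reflect ((exists i, s i = 0 :> nat) /\ valid (fun i => s i)) (low s).
Proof.
apply: (iffP andP) => [[/existsP[i /eqP si] /forallP sv]|[[i si] sv]].
  by split=> //; exists i.
by split; [apply/existsP; exists i; rewrite si | apply/forallP].
Qed.

Definition wlow : ord :=
  nsumL (fun s : {ffun 'I_n -> 'I_M.+1} => wblk (fun i => s i)) (enum low).

(** * The width of the product of X with a finite order K *)

Section Times.
Variables (K : finType) (leK : K -> K -> Prop).
Hypothesis leK_refl : forall k, leK k k.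
Hypothesis leK_trans : forall k l m, leK k l -> leK l m -> leK k m.
Hypothesis leK_anti : forall k l, leK k l -> leK l k -> k = l.
Variables (T : Type) (le : T -> T -> Prop) (p : T -> X) (q : T -> K).
Hypothesis leE : forall t t', le t t' <-> leX (p t) (p t') /\ leK (q t) (q t').
Hypothesis pq_onto : forall x k, exists t, p t = x /\ q t = k.

Notation B := ({ffun 'I_n -> 'I_M.+1} * K)%type.
Let low_blocks : seq B := [seq (s, k) | s <- enum low, k <- enum K].
Let w (b : B) : ord := wblk (fun i => b.1 i).

Lemma mem_low_blocks b : (b \in low_blocks) = low b.1.
Proof.
apply/allpairsP/idP => [[[s k] /= [sl _ ->]]|bl]; first by rewrite mem_enum in sl.
by exists b; case: b bl => s k /= sl; rewrite !mem_enum.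
Qed.

Lemma low_blocks_uniq : uniq low_blocks.
Proof. by apply: allpairs_uniq => [||[s k] [s' k'] _ _ [-> ->]]; rewrite ?enum_uniq. Qed.

Lemma le_bad_seq_free : bad_seq_free le.
Proof. exact: (pi_fin_bad_seq_free wo leK_refl leE). Qed.

Let wfT := step_wf (fun=> True) le_bad_seq_free.
Let rkT := wrank wfT.
Let rkTP : rank_fun (step le (fun=> True)) rkT := wrankP wfT.

(* Comparable blocks on a diagonal are entirely ordered, so the members of an
   antichain in a diagonal share a block, which embeds in the low one. *)
Lemma rank_upper : ole (rkT [::]) (nsumL w low_blocks).
Proof.
have /dep_choice[e /dep_choice[d eP]] := diagonal.
pose blkT t : B := (sidx (bk (e (p t))), q t).
pose part b u := map (e \o p) (filter (fun t => blkT t == b) u).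
(* A potential argument: each move strictly lowers the residual rank of its own diagonal and point
   of K and leaves the other terms alone. Moves in different terms interleave freely, hence a
   natural sum. *)
suff H u : ole (rkT u) (nsumL (fun b : B => rkb (fun i => b.1 i) (part b u)) low_blocks).
  exact: H.
elim/(well_founded_ind wfT): u => u IH; apply/oleP => z.
case/(rank_ltP _ _ rkTP) => u' u'u zu'; apply: ole_olt zu' _.
apply: ole_olt (IH _ u'u) _; case: u'u => t [-> _ tu].
have [[i0 ei0] tE tpos] := eP (p t).
have tlow : blkT t \in low_blocks.
  rewrite mem_low_blocks; apply/lowP; split=> [|i] /=.
    by exists i0; rewrite sidxE //; apply: bk_valid.
  by rewrite sidxE; apply: bk_valid.
have lt_part : olt (rkb (fun i => (blkT t).1 i) (part (blkT t) (t :: u)))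
                   (rkb (fun i => (blkT t).1 i) (part (blkT t) u)).
  apply: (rank_lt (rkbP _)); exists (e (p t)).
  rewrite /part /= eqxx; split=> //.
    by move=> i /=; rewrite sidxE //; apply: bk_valid.
  move=> z' z'u; have [t' -> t'f] := In_map z'u.
  have [/eqP[sE qE] t'u] := In_filter t'f.
  have bE i : bk (e (p t')) i = bk (e (p t)) i.
    have := congr1 (fun f : {ffun 'I_n -> 'I_M.+1} => nat_of_ord (f i)) sE.
    by rewrite /= !sidxE //; apply: bk_valid.
  have [_ t'E t'pos] := eP (p t').
  have [ntt' nt't] := tu _ t'u.
  have dE : d (p t) = d (p t').
    case: (ltngtP (d (p t)) (d (p t'))) => // dd.
      case: ntt'; apply/leE; rewrite qE; split=> //; apply/leXE => i; left.
      by rewrite tE t'E bE ltn_add2l.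
    case: nt't; apply/leE; rewrite qE; split=> //; apply/leXE => i; left.
    by rewrite tE t'E bE ltn_add2l.
  split=> H; [apply: ntt'|apply: nt't]; apply/leE; rewrite qE; split=> //.
    apply: pos_leX => i; first by rewrite tE t'E bE dE.
    apply: ole_trans (proj2 (tpos i)) _; apply: ole_trans (proj1 (t'pos i)).
    by apply: leX_pos H _; rewrite bE.
  apply: pos_leX => i; first by rewrite tE t'E bE dE.
  apply: ole_trans (proj2 (t'pos i)) _; apply: ole_trans (proj1 (tpos i)).
  by apply: leX_pos H _; rewrite bE.
apply: (nsumL_lt _ tlow lt_part) => b _.
case: (eqVneq (blkT t) b) => [<-|tb]; first exact: oltW.
by rewrite /part /= (negbTE tb); apply: ole_refl.
Qed.

Let blk_le (b c : B) : Prop := (forall i, b.1 i <= c.1 i) /\ leK b.2 c.2.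

(** Two demands meet here: the block played next must have least width, to be the last summand, and
    must not lie below a block still to be played, which its points could spoil. They are compatible
    because by [wblk_le] a block above [b] has width at most that of [b]; only ties need the order
    on blocks, and the lexicographic combination [prec] is a strict order. *)
Lemma next_block (Q : seq B) : {subset Q <= low_blocks} -> Q <> [::] ->
  exists2 b, b \in Q & forall c, c \in Q -> ole (w b) (w c) /\ (blk_le b c -> c = b).
Proof.
move=> Qlow; pose prec (c b : B) := olt (w c) (w b) \/
  [/\ ole (w c) (w b), blk_le b c & c <> b].
have blk_le_trans b c d : blk_le b c -> blk_le c d -> blk_le b d.
  by move=> [b1 b2] [c1 c2]; split=> [i|]; [apply: leq_trans (c1 i)|apply: leK_trans c2].
have blk_le_anti b c : blk_le b c -> blk_le c b -> b = c.
  case: b c => [s k] [s' k'] [/= ss' kk'] [/= s's k'k]; congr (_, _); last exact: leK_anti.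
  by apply/ffunP => i; apply/val_inj/eqP; rewrite eqn_leq ss' s's.
case/(minimal_member (prec := prec)) => [a [/olt_irrefl//|[]//]|c b a|b bQ bmin].
  case=> [cb|[cb bc ncb]] [ba|[ba ab nba]].
  - by left; apply: olt_trans ba.
  - by left; apply: oltW_ole ba.
  - by left; apply: ole_olt ba.
  right; split; [exact: ole_trans cb ba|exact: blk_le_trans ab bc|].
  by move=> ca; subst c; apply: nba; apply: blk_le_anti.
exists b => // c cQ; split; first by apply: onlt => cb; case: (bmin c cQ); left.
move=> bc; apply: NNPP => ncb; case: (bmin c cQ); right; split=> //.
apply: wblk_le; last by case: bc.
by have := Qlow c cQ; rewrite mem_low_blocks => /lowP[].
Qed.

(* A low block is entered only after the larger ones; by lowness a copy of it
   remains that is incomparable to all earlier moves. *)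
Lemma shift_block (b : B) (t : seq T) : low b.1 ->
  (forall z, List.In z t ->
     (exists i, bk (p z) i = 0) /\ ~ ((forall i, bk (p z) i <= b.1 i) /\ leK (q z) b.2)) ->
  exists e : X -> T, forall x, inblk (fun i => b.1 i) x ->
    [/\ inblk (fun i => b.1 i) (p (e x)), q (e x) = b.2,
        forall z, List.In z t -> incomp le (e x) z &
        forall y, inblk (fun i => b.1 i) y -> le (e x) (e y) -> leX x y].
Proof.
move=> /lowP[_ bv] tP; pose s i : nat := b.1 i.
(* Room is made only in coordinates where [b] has index 0; the limit length there gives a bound
   strictly above the earlier moves. Elsewhere the shift is 0. *)
have /dep_choice[g gP] i : exists g, olt g (len (D i) (s i)) /\ (s i = 0 ->
    forall z, List.In z t -> bk (p z) i = 0 -> olt (pos (p z) i) g).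
  have l0 := len_gt0 (b := D i) (bv i).
  have [s0|ns0] := classic (s i = 0); last by exists ozero.
  have [z _ z0|c cl cP] := @list_bound _ (fun z => pos (p z) i)
    (fun z => bk (p z) i = 0) _ t l0.
    by rewrite -/(s i) s0 -z0; apply: off_lt.
  rewrite -/(s i) s0 in cl *; have [c' cc' c'l] := len0_limit cl.
  by exists c'; split=> // _ z zt z0; apply: ole_olt cc'; apply: cP.
have /dep_choice[e eP] x : exists t', inblk s x -> [/\ inblk s (p t'), q t' = b.2 &
    forall i, oeq (pos (p t') i) (osum (g i) (pos x i))].
  have [xs|nxs] := classic (inblk s x); last first.
    by have [t' _] := pq_onto x b.2; exists t'.
  have [|y [ys yE]] := @point s (fun i => osum (g i) (pos x i)) bv.
    by move=> i; apply: (len_indec (b := D i) (bv i)); [case: (gP i) | exact: (pos_lt i xs)].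
  by have [t' [pt qt]] := pq_onto y b.2; exists t' => _; rewrite pt.
exists e => x xs; have [exs qx xE] := eP x xs; split=> // [z zt|y ys].
  (* In the coordinate [i] where [z] lies in the first block, the image of [x] has either a larger
     block index or a larger offset, so it is not below [z]. The converse comparison is excluded by
     block indices and K alone. *)
  have [[i zi] nzb] := tP z zt; split=> /leE[xz qz].
    have := leX_bk xz i; rewrite zi leqn0 exs => /eqP si.
    have [_ /(_ si z zt zi) zg] := gP i.
    apply: (ole_nlt (ole_trans (proj2 (xE i)) (leX_pos xz _))); first by rewrite exs si zi.
    exact: oltW_ole zg (osum_ge_l _ _).
  apply: nzb; split; last by rewrite -qx.
  by move=> j; have := leX_bk xz j; rewrite exs.
have [eys qy yE] := eP y ys; case/leE => xy _.
apply: pos_leX => i; first by rewrite xs ys.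
apply: (@osum_le2lE (g i)); apply: ole_trans (proj2 (xE i)) _.
by apply: ole_trans (proj1 (yE i)); apply: leX_pos xy _; rewrite exs eys.
Qed.

(* The blocks of least width are played first, so the ranks add up to an ordinary
   sum of indecomposables in decreasing order, which is the natural sum. *)
Lemma rank_lower_from (Q : seq B) (t : seq T) :
  uniq Q -> {subset Q <= low_blocks} ->
  (forall z, List.In z t -> (exists i, bk (p z) i = 0) /\
     forall b, b \in Q -> ~ ((forall i, bk (p z) i <= b.1 i) /\ leK (q z) b.2)) ->
  ole (nsumL w Q) (rkT t).
Proof.
have [k kQ] := ubnP (size Q); elim: k Q t kQ => // k IH Q t kQ Quniq Qlow tP.
have [->|/next_block] := classic (Q = [::]); first exact: ozero_le.
case=> // b bQ bmin.
have Q'Q : {subset rem b Q <= Q} by apply: mem_rem.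
have lowQ c : c \in Q -> low c.1 by move=> /Qlow; rewrite mem_low_blocks.
have validQ c : c \in Q -> valid (fun i => c.1 i) by move=> /lowQ/lowP[].
have [e eP] : exists e : X -> T, _ := @shift_block b t (lowQ b bQ)
  (fun z zt => conj (proj1 (tP z zt)) (proj2 (tP z zt) b bQ)).
apply: ole_trans (proj1 (nsumL_rem w bQ)) _.
apply: ole_trans (nsum_leC _ _) _; apply: ole_trans (nsumL_le_osum _ _) _.
- by move=> c /Q'Q cQ; apply/indec_nindec/wblk_indec/validQ.
- by move=> c /Q'Q cQ; case: (bmin c cQ).
(* The block [b] is copied first, so its width is the right summand; the induction hypothesis
   provides the remaining blocks after any finite number of moves in [b]. *)
apply: (rank_simulation (Sim := fun u v => v = map e u ++ t /\
  forall z, List.In z u -> inblk (fun i => b.1 i) z) (step_wf _ leX_bad_seq_free)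
  (rkbP _) rkTP); last by split.
- move=> u v [-> ub]; apply: IH; rewrite ?rem_uniq //.
  + by rewrite size_rem // -ltnS (leq_trans _ kQ) // ltnS; case: (Q) bQ.
  + by move=> c /Q'Q/Qlow.
  move=> z zut; have [zu|zt] := proj1 (In_cat _ _ _) zut; last first.
    by have [z0 zQ] := tP z zt; split=> // c /Q'Q; apply: zQ.
  have [x -> xu] := In_map zu; have [exb qx _ _] := eP x (ub x xu); split.
    by have /lowP[[i bi] _] := lowQ b bQ; exists i; rewrite exb.
  move=> c; rewrite mem_rem_uniq // inE => /andP[/eqP cb cQ] [bc qbc].
  have [_ cE] := bmin c cQ; apply: cb; apply: cE; split; last by rewrite -qx.
  by move=> i; rewrite -exb.
move=> u v u' [-> ub] u'u; exists (map e u' ++ t); last first.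
  by case: u'u => y [-> yb _]; split=> // z [<-|/ub].
apply: step_map u'u => // [x y xb yb exy|x z xb zt].
  by case: (eP x xb) => _ _ _ /(_ y yb); apply.
by case: (eP x xb) => _ _ /(_ z zt).
Qed.

(** Working with [p] and [q] on an abstract [T], instead of with pairs, lets X itself be the
    instance where K is a point. *)
Lemma width_times : width_is le (nmul_nat wlow #|K|).
Proof.
apply: (width_of_rank rkTP); apply: (@oeq_trans (nsumL w low_blocks)).
  by rewrite cardE; apply/oeq_sym/nsumL_pairs.
split; last exact: rank_upper.
by apply: rank_lower_from => //; apply: low_blocks_uniq.
Qed.

End Times.
End Product.

Theorem mainTheorem13 (n : nat) (A : 'I_n -> Type)
  (leA : forall i : 'I_n, A i -> A i -> Prop)
  (hn : (0 < n)%N)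
  (hwo : forall i : 'I_n, well_order (leA i))
  (hinf : forall i : 'I_n, infinite_type (A i))
  (m : nat) (k : 'I_m -> nat) :
  exists o : ord,
    width_is (pi_le leA) o /\
    width_is (pair_le (pi_le leA) (@box_le m k))
      (foldl nmul_nat o [seq k j | j <- enum 'I_m]).
Proof.
have /dep_choice[D _] i : exists _ : blocks (leA i), True.
  by have [b] := blocks_exist (hwo i) (hinf i); exists b.
(* The factor 1 is the cardinality of [unit], the one-point K. *)
exists (nmul_nat (wlow hwo D) 1); split.
  rewrite -card_unit.
  apply: (@width_times _ _ _ hwo D hn unit (fun _ _ => True) _ _ _ _ _ id (fun=> tt)) => //.
  - by case=> [] [].
  - by move=> x y; split=> [|[]].
  by move=> x []; exists x.
(* The box consists of plain dependent functions; finite functions give it a [finType] structure,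
   with pointwise conversion as the map [q]. If some [k j] is 0, then K is empty and both sides are
   0. *)
pose K : finType := {dffun forall j, 'I_(k j)}.
pose leK (x y : K) := forall j, x j <= y j.
have wK : width_is (pair_le (pi_le leA) (@box_le m k)) (nmul_nat (wlow hwo D) #|K|).
  apply: (@width_times _ _ _ hwo D hn K leK _ _ _ _ _ fst
            (fun t => [ffun j => t.2 j])).
  - by move=> x j.
  - by move=> x y z xy yz j; apply: leq_trans (yz j).
  - by move=> x y xy yx; apply/ffunP => j; apply/val_inj/eqP; rewrite eqn_leq xy yx.
  - by move=> x y; split=> -[xy xy2]; split=> // j; have := xy2 j; rewrite !ffunE.
  by move=> x f; exists (x, fun j => f j); split=> //; apply/ffunP => j; rewrite ffunE.
case: wK => rho [rhoP rhoE]; exists rho; split=> //; apply: oeq_trans rhoE.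
apply: oeq_trans (foldl_nmul_nat _ _) _; rewrite card_dep_ffun.
suff -> : [seq #|'I_(k j)| | j : 'I_m] = [seq k j | j <- enum 'I_m].
  exact: nmul_nat_oeq (nmul_nat1 _).
by apply: eq_map => j; rewrite card_ord.
Qed.
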